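(* Let $(E,A)$ be a $W^*$-correspondence and $\sigma:A\to B(H)$ a normal $*$-representation. Suppose $g\in \mathrm{Aut}(\mathbb{D}((E^{\sigma})^{*}))$ implements an automorphism $\alpha\in \mathrm{Aut}(H^{\infty}(E))$, so that $g(\eta^{*})=g_{\gamma}(\eta^{*})(u\otimes I_{H})$ for all $\eta^*\in\mathbb{D}((E^{\sigma})^{*})$, where $\gamma^{*}\in\mathbb{D}\mathfrak{Z}((E^{\sigma})^{*})$ and $u$ is a unitary in $\mathscr{L}(E)$ with $u(\mathfrak{Z}(E))=\mathfrak{Z}(E)$. Then for every $\eta^*\in\mathbb{D}((E^{\sigma})^{*})$ one has, as an equality of elements of $\mathbb{P}$, $$[I_{H}\quad \eta^{*}]\begin{pmatrix}\Delta_{\gamma}^{-1} & \gamma^{*}\Delta_{\gamma^{*}}^{-1}(u\otimes I_{H})\\ -\gamma\Delta_{\gamma}^{-1} & -\Delta_{\gamma^{*}}^{-1}(u\otimes I_{H})\end{pmatrix}=[I_{H}\quad g(\eta^{*})].$$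
   Context: A $W^*$-correspondence $(E,A)$ is a selfdual right Hilbert $C^*$-module $E$ over a $W^*$-algebra $A$ together with a unital normal $*$-homomorphism $\varphi:A\to\mathscr{L}(E)$ into the adjointable maps on $E$ (the left action, $a\cdot x=\varphi(a)x$). Its center is $\mathfrak{Z}(E)=\{x\in E: a\cdot x=x\cdot a\ \forall a\in A\}$. For a normal $*$-representation $\sigma:A\to B(H)$, $E\otimes_\sigma H$ is the Hilbert space interior tensor product, and $(E^{\sigma})^{*}=\{\eta^*\in B(E\otimes_\sigma H,H):\eta^*(\varphi(a)\otimes I_H)=\sigma(a)\eta^*\ \forall a\in A\}$; $E^\sigma$ is the set of adjoints $\eta$ of its elements. $\mathbb{D}((E^{\sigma})^{*})$ is the open unit ball of $(E^{\sigma})^{*}$ and $\mathrm{Aut}(\mathbb{D}((E^{\sigma})^{*}))$ its group of biholomorphic self-maps. The center $\mathfrak{Z}((E^{\sigma})^{*})$ is $\{\eta^*\in (E^\sigma)^*: b\,\eta^*=\eta^*(I_E\otimes b)\ \forall b\in\sigma(A)'\}$ and $\mathbb{D}\mathfrak{Z}((E^{\sigma})^{*})$ is its open unit ball. For $\gamma\in E^\sigma$, $\|\gamma\|<1$: $\Delta_{\gamma}=(I_{H}-\gamma^{*}\gamma)^{1/2}$, $\Delta_{\gamma^{*}}=(I_{E\otimes H}-\gamma\gamma^{*})^{1/2}$, and the Möbius map is $g_{\gamma}(\eta^{*})=\Delta_{\gamma}(I_{H}-\eta^{*}\gamma)^{-1}(\gamma^{*}-\eta^{*})\Delta_{\gamma^{*}}^{-1}$.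 $H^\infty(E)$ is the Hardy algebra of $E$: the ultraweak closure, in the adjointable operators on the Fock space $\mathscr{F}(E)=\bigoplus_{n\ge0}E^{\overline\otimes n}$ (ultraweak direct sum), of the algebra generated by the left action $\varphi_\infty(A)$ of $A$ on $\mathscr{F}(E)$ and the creation operators $T_x(\xi)=x\otimes \xi$, $x\in E$. $\mathrm{Aut}(H^{\infty}(E))$ is the group of completely isometric, weak$^*$-homeomorphic automorphisms of $H^{\infty}(E)$ fixing $\varphi_\infty(A)$ elementwise. For $X\in H^\infty(E)$ and $\eta^*\in\mathbb{D}((E^{\sigma})^{*})$, $\widehat X(\eta^* )=(\sigma\times\eta^* )(X)\in B(H)$, where $\sigma\times\eta^*$ is the ultraweakly continuous completely contractive representation of $H^\infty(E)$ with $\varphi_\infty(a)\mapsto\sigma(a)$ and $T_x\mapsto(h\mapsto\eta^*(x\otimes h))$. The map $g$ implements $\alpha$ if $\widehat{\alpha(X)}(\eta^* )=\widehat X(g(\eta^* ))$ for all $X$, $\eta^*$. (It is known, by work of Muhly and Solel, that such a $g$ has the form $g(\eta^* )=g_\gamma(\eta^* )(u\otimes I_H)$ with $\gamma,u$ as in the claim.) $\mathbb{P}$ is the set of pairs $(U,\eta^* )$ with $U$ an invertible operator in $\sigma(A)'$ and $\eta^*\in(E^\sigma)^*$, modulo $(U_1,\eta_1^* )\sim(U_2,\eta_2^* )$ iff there is an invertible $C\in\sigma(A)'$ with $(CU_1,C\eta_1^* )=(U_2,\eta_2^* )$. The class of $(U,\eta^* )$ is written $[U\quad\eta^*]$ and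 also viewed as a $1\times2$ block row; a $2\times 2$ block matrix acts on it by right matrix multiplication (take the class of the resulting row). *)

(* Defs.v *)
(* Complex scalars are [R[i]] for [R : realType]; every inner product is linear
   in its SECOND variable.  Operators are plain functions with predicates; the
   operations that are unique when they exist (adjoint, inverse, square root,
   ...) are chosen by [xget] among the functions with the defining property. *)
From HB Require Import structures.
From mathcomp Require Import all_boot all_order all_algebra.
From mathcomp Require Import all_classical reals topology normedtype.
From mathcomp Require Import complex.

Set Implicit Arguments.
Unset Strict Implicit.
Unset Printing Implicit Defensive.
Import Order.TTheory GRing.Theory Num.Theory numFieldNormedType.Exports.
Local Open Scope classical_set_scope.
Local Open Scope ring_scope.

(* The library norm of a normed module over [R[i]] has values in [R[i]]. *)
Definition nrm (R : realType) (V : normedModType R[i]) (x : V) : R :=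
  complex.Re `|x|.

Definition cmod (R : realType) (z : R[i]) : R := complex.Re `|z|.

Definition bounded_linear (R : realType) (U V : normedModType R[i])
    (f : U -> V) : Prop :=
  linear f /\ exists c : R, forall x, nrm (f x) <= c * nrm x.

Definition opnorm (R : realType) (U V : normedModType R[i]) (f : U -> V) : R :=
  inf [set c : R | 0 <= c /\ forall x, nrm (f x) <= c * nrm x].

Definition is_inverse (R : realType) (U V : normedModType R[i])
    (f : U -> V) (f' : V -> U) : Prop :=
  [/\ bounded_linear f', cancel f f' & cancel f' f].

Definition inverse_op (R : realType) (U V : normedModType R[i])
    (f : U -> V) : V -> U := xget (fun=> 0) [set f' | is_inverse f f'].

Definition invertible_op (R : realType) (U V : normedModType R[i])
    (f : U -> V) : Prop := exists f', is_inverse f f'.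

Definition lspan (R : realType) (V : lmodType R[i]) (S : set V) : set V :=
  [set v | exists (n : nat) (c : 'I_n -> R[i]) (s : 'I_n -> V),
     (forall i, S (s i)) /\ v = \sum_(i < n) c i *: s i].

(* ** Weak topologies given by a set [P] of functionals on a subset [D] *)

(* Norm closure of [P] in the dual of the normed space [(D, nV)]. *)
Definition dual_closure (R : realType) (V : Type) (D : set V) (nV : V -> R)
    (P : set (V -> R[i])) : set (V -> R[i]) :=
  [set f : V -> R[i] | forall e : R, 0 < e -> exists2 p, P p &
     forall v, D v -> cmod (f v - p v) <= e * nV v].

Definition wclosure (R : realType) (V : Type) (D : set V)
    (P : set (V -> R[i])) (S : set V) : set V :=
  [set v | D v /\
     forall (n : nat) (p : 'I_n -> V -> R[i]) (e : R), 0 < e ->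
       (forall i, P (p i)) ->
       exists2 s, S s & forall i, cmod (p i s - p i v) < e].

Definition wcontinuous (R : realType) (V W : Type) (D : set V)
    (P : set (V -> R[i])) (Q : set (W -> R[i])) (f : V -> W) : Prop :=
  forall (x : V) (q : W -> R[i]) (e : R), D x -> Q q -> 0 < e ->
    exists (n : nat) (p : 'I_n -> V -> R[i]) (d : R),
      [/\ 0 < d, (forall i, P (p i)) &
          forall y, D y -> (forall i, cmod (p i y - p i x) < d) ->
            cmod (q (f y) - q (f x)) < e].

(* Norm of an [n x n] matrix of operators, for norms [N], [N'] on [n]-vectors. *)
Definition mx_opnorm (R : realType) (n : nat) (V W : zmodType)
    (N : ('I_n -> V) -> R) (N' : ('I_n -> W) -> R)
    (X : 'I_n -> 'I_n -> V -> W) : R :=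
  inf [set c : R | 0 <= c /\
    forall x, N' (fun i => \sum_(j < n) X i j (x j)) <= c * N x].

(* ** Hilbert spaces *)

HB.mixin Record isHilbert (R : realType) H of CompleteNormedModule R[i] H := {
  inner : H -> H -> R[i];
  inner_linear : forall x, linear (inner x : H -> R[i]^o);
  inner_conj : forall x y, Num.conj (inner x y) = inner y x;
  inner_norm : forall x, inner x x = `|x| ^+ 2
}.

#[short(type="hilbertType")]
HB.structure Definition Hilbert (R : realType) :=
  {H of CompleteNormedModule R[i] H & isHilbert R H}.

Section HilbertOperators.
Context {R : realType}.
Implicit Types H K : hilbertType R.

Definition is_adjoint H K (f : H -> K) (f' : K -> H) : Prop :=
  forall x y, inner (f x) y = inner x (f' y).

Definition adjoint_op H K (f : H -> K) : K -> H :=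
  xget (fun=> 0) [set f' | bounded_linear f' /\ is_adjoint f f'].

Definition positive_op H (f : H -> H) : Prop := forall x, 0 <= inner x (f x).

Definition sqrt_op H (f : H -> H) : H -> H :=
  xget (fun=> 0)
    [set s | [/\ bounded_linear s, positive_op s & s \o s = f]].

Definition BH_predual H : set ((H -> H) -> R[i]) :=
  dual_closure (@bounded_linear R H H) (@opnorm R H H)
    (lspan [set p : (H -> H) -> R[i]^o |
       exists x y : H, p = fun T => inner x (T y)]).

Definition hvec_norm H (n : nat) (x : 'I_n -> H) : R :=
  Num.sqrt (\sum_(i < n) nrm (x i) ^+ 2).

End HilbertOperators.

(* ** C*-algebras and W*-algebras *)

(* Unital; the zero algebra is not excluded.  The product is declared here
   because the hierarchy of algebraic structures has no join of rings and
   normed modules. *)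
HB.mixin Record isCStar (R : realType) A of CompleteNormedModule R[i] A := {
  amul : A -> A -> A;
  aone : A;
  star : A -> A;
  amulA : associative amul;
  amul1l : left_id aone amul;
  amul1r : right_id aone amul;
  amul_linear_l : forall b, linear (amul^~ b);
  amul_linear_r : forall a, linear (amul a);
  amul_norm : forall a b : A, `|amul a b| <= `|a| * `|b|;
  starK : involutive star;
  starD : forall a b, star (a + b) = star a + star b;
  starZ : forall (c : R[i]) a, star (c *: a) = Num.conj c *: star a;
  starM : forall a b, star (amul a b) = amul (star b) (star a);
  cstar_norm : forall a : A, `|amul (star a) a| = `|a| ^+ 2
}.

#[short(type="cstarType")]
HB.structure Definition CStar (R : realType) :=
  {A of CompleteNormedModule R[i] A & isCStar R A}.

(* Sakai's definition: a C*-algebra that is a dual Banach space.  The (unique)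
   predual is realised as a closed subspace of the dual of [A]; the last two
   fields say that evaluation [A -> predual^*] is isometric and onto. *)
HB.mixin Record isWStar (R : realType) A of CStar R A := {
  predual : set (A -> R[i]);
  predual_bounded : forall w, predual w ->
    linear (w : A -> R[i]^o) /\
    exists c : R, forall a, cmod (w a) <= c * nrm a;
  predual0 : predual (fun=> 0);
  predual_lin : forall (c : R[i]) w w', predual w -> predual w' ->
    predual (fun a => c * w a + w' a);
  predual_closed :
    dual_closure setT (@nrm R A) predual `<=` predual;
  predual_norming : forall (a : A) (c : R), 0 <= c ->
    (forall w, predual w -> (forall b, cmod (w b) <= nrm b) ->
       cmod (w a) <= c) -> nrm a <= c;
  predual_onto : forall Phi : (A -> R[i]) -> R[i],
    (forall (c : R[i]) w w', predual w -> predual w' ->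
       Phi (fun a => c * w a + w' a) = c * Phi w + Phi w') ->
    (exists c : R, forall w (m : R), predual w -> 0 <= m ->
       (forall b, cmod (w b) <= m * nrm b) -> cmod (Phi w) <= c * m) ->
    exists a, forall w, predual w -> Phi w = w a
}.

#[short(type="wstarType")]
HB.structure Definition WStar (R : realType) :=
  {A of CStar R A & isWStar R A}.

(* ** Hilbert C*-modules *)

HB.mixin Record isHilbertModule (R : realType) (A : cstarType R) E
    of CompleteNormedModule R[i] E := {
  ract : E -> A -> E;
  minner : E -> E -> A;
  ractA : forall x a b, ract x (amul a b) = ract (ract x a) b;
  ract1 : forall x, ract x aone = x;
  ractDl : forall x y a, ract (x + y) a = ract x a + ract y a;
  ractDr : forall x a b, ract x (a + b) = ract x a + ract x b;
  ractZl : forall (c : R[i]) x a, ract (c *: x) a = c *: ract x a;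
  ractZr : forall (c : R[i]) x a, ract x (c *: a) = c *: ract x a;
  minner_linear : forall x, linear (minner x);
  minner_ract : forall x y a, minner x (ract y a) = amul (minner x y) a;
  minner_star : forall x y, star (minner x y) = minner y x;
  minner_ge0 : forall x, exists b, minner x x = amul (star b) b;
  minner_norm : forall x : E, `|minner x x| = `|x| ^+ 2
}.

#[short(type="hilbertModType")]
HB.structure Definition HilbertModule (R : realType) (A : cstarType R) :=
  {E of CompleteNormedModule R[i] E & isHilbertModule R A E}.

Definition is_madjoint (R : realType) (A : cstarType R)
    (M N : hilbertModType A) (T : M -> N) (T' : N -> M) : Prop :=
  forall x y, minner (T x) y = minner x (T' y).

Definition adjointable (R : realType) (A : cstarType R)
    (M N : hilbertModType A) (T : M -> N) : Prop :=
  exists T', is_madjoint T T'.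

Definition unitary_op (R : realType) (A : cstarType R) (M : hilbertModType A)
    (u : M -> M) : Prop :=
  exists u', [/\ is_madjoint u u', cancel u u' & cancel u' u].

Definition selfdual (R : realType) (A : cstarType R) (M : hilbertModType A) :
    Prop :=
  forall f : M -> A, bounded_linear f ->
    (forall x a, f (ract x a) = amul (f x) a) -> exists y, f = minner y.

(* The (Paschke) preduals of a selfdual module [M] over a W*-algebra and of
   its algebra of adjointable operators. *)
Definition mod_predual (R : realType) (A : wstarType R)
    (M : hilbertModType A) : set (M -> R[i]) :=
  dual_closure setT (@nrm R M)
    (lspan [set p : M -> R[i]^o | exists (w : A -> R[i]) (y : M),
       predual w /\ p = fun x => w (minner y x)]).

Definition LM_predual (R : realType) (A : wstarType R)
    (M : hilbertModType A) : set ((M -> M) -> R[i]) :=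
  dual_closure (@adjointable R A M M) (@opnorm R M M)
    (lspan [set p : (M -> M) -> R[i]^o |
       exists (w : A -> R[i]) (x y : M),
         predual w /\ p = fun T => w (minner x (T y))]).

Definition mvec_norm (R : realType) (A : cstarType R) (M : hilbertModType A)
    (n : nat) (x : 'I_n -> M) : R :=
  Num.sqrt (nrm (\sum_(i < n) minner (x i) (x i))).

(* ** W*-correspondences *)

HB.mixin Record isWCorr (R : realType) (A : wstarType R) E
    of HilbertModule R A E := {
  wcorr_selfdual : selfdual (E : hilbertModType A);
  lact : A -> E -> E;
  lact_linear : forall x, linear (lact^~ x);
  lact1 : forall x, lact aone x = x;
  lactM : forall a b x, lact (amul a b) x = lact a (lact b x);
  lact_star : forall a x y,
    minner (lact a x) y = minner x (lact (star a) y) :> A;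
  lact_normal : forall f, LM_predual f -> predual (fun a : A => f (lact a))
}.

#[short(type="wcorrType")]
HB.structure Definition WCorr (R : realType) (A : wstarType R) :=
  {E of HilbertModule R A E & isWCorr R A E}.

Definition corr_center (R : realType) (A : wstarType R) (E : wcorrType A) : set E :=
  [set x | forall a : A, lact a x = ract x a].
Arguments corr_center {R A} E _.

(* ** Intertwiners between the left action and a representation *)

Definition normal_rep (R : realType) (A : wstarType R) (H : hilbertType R)
    (sigma : A -> H -> H) : Prop :=
  [/\ (forall a, bounded_linear (sigma a)),
      (forall h, linear (sigma^~ h)),
      (forall a b, sigma (amul a b) = sigma a \o sigma b),
      (forall a, is_adjoint (sigma a) (sigma (star a))) &
      (forall f, BH_predual f -> predual (fun a => f (sigma a)))].

Definition rep_commutant (R : realType) (A : wstarType R) (H : hilbertType R)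
    (sigma : A -> H -> H) : set (H -> H) :=
  [set b | bounded_linear b /\ forall a, b \o sigma a = sigma a \o b].

(* Any realisation of the interior tensor product of [E] and [H] over [sigma];
   the two axioms determine it up to a unique unitary. *)
Record interior_tensor (R : realType) (A : wstarType R) (E : wcorrType A)
    (H : hilbertType R) (sigma : A -> H -> H) := InteriorTensor {
  tensor_space :> hilbertType R;
  tensor : E -> H -> tensor_space;
  tensor_inner : forall x y h k,
    inner (tensor x h) (tensor y k) = inner h (sigma (minner x y) k);
  tensor_dense :
    dense (lspan [set v | exists x h, v = tensor x h])
}.

Section Intertwiners.
Context {R : realType} {A : wstarType R} {E : wcorrType A} {H : hilbertType R}.
Context {sigma : A -> H -> H} (K : interior_tensor E sigma).

(* [T \otimes I_H] and [I_E \otimes b]. *)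
Definition tensor_l (T : E -> E) : K -> K :=
  xget (fun=> 0) [set V | bounded_linear V /\
    forall x h, V (tensor K x h) = tensor K (T x) h].

Definition tensor_r (b : H -> H) : K -> K :=
  xget (fun=> 0) [set V | bounded_linear V /\
    forall x h, V (tensor K x h) = tensor K x (b h)].

Definition EsigmaS : set (K -> H) :=
  [set eta | bounded_linear eta /\
     forall a : A, eta \o tensor_l (lact a) = sigma a \o eta].

Definition Esigma : set (H -> K) :=
  [set eta | bounded_linear eta /\
     exists2 etaS, EsigmaS etaS & is_adjoint etaS eta].

Definition ball_EsigmaS : set (K -> H) :=
  [set eta | EsigmaS eta /\ opnorm eta < 1].

Definition center_EsigmaS : set (K -> H) :=
  [set eta | EsigmaS eta /\
     forall b, rep_commutant sigma b -> b \o eta = eta \o tensor_r b].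

Definition ball_center_EsigmaS : set (K -> H) :=
  [set eta | center_EsigmaS eta /\ opnorm eta < 1].

(* Complex Frechet differentiability at every point of the ball of the Banach
   space [EsigmaS]. *)
Definition holomorphic_ball (g : (K -> H) -> (K -> H)) : Prop :=
  forall eta, ball_EsigmaS eta ->
    exists L : (K -> H) -> (K -> H),
      [/\ (forall z, EsigmaS z -> EsigmaS (L z)),
          (forall (c : R[i]) z z', EsigmaS z -> EsigmaS z' ->
             L (c *: z + z') = c *: L z + L z'),
          (exists m : R, forall z, EsigmaS z -> opnorm (L z) <= m * opnorm z) &
          forall e : R, 0 < e -> exists2 d : R, 0 < d &
            forall z, EsigmaS z -> opnorm z < d ->
              opnorm (g (eta + z) - g eta - L z) <= e * opnorm z].

Definition Aut_ball (g : (K -> H) -> (K -> H)) : Prop :=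
  exists g' : (K -> H) -> (K -> H),
    [/\ set_fun ball_EsigmaS ball_EsigmaS g,
        set_fun ball_EsigmaS ball_EsigmaS g',
        {in ball_EsigmaS, cancel g g'}, {in ball_EsigmaS, cancel g' g} &
        holomorphic_ball g /\ holomorphic_ball g'].

Definition Delta (gamma : H -> K) : H -> H :=
  sqrt_op (idfun - (adjoint_op gamma \o gamma)).

Definition DeltaS (gamma : H -> K) : K -> K :=
  sqrt_op (idfun - (gamma \o adjoint_op gamma)).

Definition mobius (gamma : H -> K) (eta : K -> H) : K -> H :=
  Delta gamma \o inverse_op (idfun - (eta \o gamma)) \o (adjoint_op gamma - eta)
    \o inverse_op (DeltaS gamma).

(* ** The projective space of rows [U  eta] *)

Definition Prow : set ((H -> H) * (K -> H)) :=
  [set p | [/\ rep_commutant sigma p.1, invertible_op p.1 & EsigmaS p.2]].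

Definition Pequiv (p q : (H -> H) * (K -> H)) : Prop :=
  exists C : H -> H,
    [/\ rep_commutant sigma C, invertible_op C & (C \o p.1, C \o p.2) = q].

(* The class of [p], meaningful for [p] in [Prow]. *)
Definition Pclass (p : (H -> H) * (K -> H)) : set ((H -> H) * (K -> H)) :=
  [set q | Prow q /\ Pequiv p q].

Record block_mx2 := BlockMx2 {
  b11 : H -> H; b12 : K -> H;
  b21 : H -> K; b22 : K -> K }.

Definition block_row_mul (p : (H -> H) * (K -> H)) (M : block_mx2) :
    (H -> H) * (K -> H) :=
  ((p.1 \o b11 M) + (p.2 \o b21 M), (p.1 \o b12 M) + (p.2 \o b22 M)).

Definition mobius_mx (gamma : H -> K) (u : E -> E) : block_mx2 :=
  BlockMx2
    (inverse_op (Delta gamma))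
    (adjoint_op gamma \o inverse_op (DeltaS gamma) \o tensor_l u)
    (- (gamma \o inverse_op (Delta gamma)))
    (- (inverse_op (DeltaS gamma) \o tensor_l u)).

End Intertwiners.

(* ** The Fock correspondence and the Hardy algebra *)

Definition uw_total (R : realType) (A : wstarType R) (M : wcorrType A)
    (S : set M) : Prop :=
  wclosure setT (@mod_predual R A M) (lspan S) = setT.

(* Any realisation of the Fock correspondence of [E], determined up to a unique
   isomorphism: [fock_pow 0] is [A], [fock_pow n.+1] is the selfdual tensor
   product of [E] and [fock_pow n], and [fock_space] is the ultraweak direct
   sum of the [fock_pow n]. *)
Record fock (R : realType) (A : wstarType R) (E : wcorrType A) := Fock {
  fock_pow : nat -> wcorrType A;
  fock_unit : A -> fock_pow 0;
  fock_unit_bij : bijective fock_unit;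
  fock_unit_inner : forall a b,
    minner (fock_unit a) (fock_unit b) = amul (star a) b;
  fock_unit_ract : forall a b, ract (fock_unit a) b = fock_unit (amul a b);
  fock_unit_lact : forall a b, lact a (fock_unit b) = fock_unit (amul a b);
  fock_tensor : forall n, E -> fock_pow n -> fock_pow n.+1;
  fock_tensor_inner : forall n x y (xi zeta : fock_pow n),
    minner (fock_tensor x xi) (fock_tensor y zeta) =
    minner xi (lact (minner x y) zeta);
  fock_tensor_ract : forall n x (xi : fock_pow n) (a : A),
    ract (fock_tensor x xi) a = fock_tensor x (ract xi a);
  fock_tensor_lact : forall n x (xi : fock_pow n) (a : A),
    lact a (fock_tensor x xi) = fock_tensor (lact a x) xi;
  fock_tensor_total : forall n,
    uw_total [set z : fock_pow n.+1 | exists x xi, z = fock_tensor x xi];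
  fock_space : wcorrType A;
  fock_inj : forall n, fock_pow n -> fock_space;
  fock_inj_inner : forall n (xi zeta : fock_pow n),
    minner (fock_inj xi) (fock_inj zeta) = minner xi zeta;
  fock_inj_orth : forall m n (xi : fock_pow m) (zeta : fock_pow n),
    m != n -> minner (fock_inj xi) (fock_inj zeta) = 0;
  fock_inj_ract : forall n (xi : fock_pow n) (a : A),
    ract (fock_inj xi) a = fock_inj (ract xi a);
  fock_inj_lact : forall n (xi : fock_pow n) (a : A),
    lact a (fock_inj xi) = fock_inj (lact a xi);
  fock_inj_total :
    uw_total [set z | exists n (xi : fock_pow n), z = fock_inj xi]
}.

Inductive alg_gen (R : realType) (V : lmodType R[i]) (G : set (V -> V)) :
    (V -> V) -> Prop :=
| alg_gen_in X of G X : alg_gen G X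
| alg_gen_add X Y of alg_gen G X & alg_gen G Y : alg_gen G (X + Y)
| alg_gen_scale (c : R[i]) X of alg_gen G X : alg_gen G (c *: X)
| alg_gen_comp X Y of alg_gen G X & alg_gen G Y : alg_gen G (X \o Y).

Section Hardy.
Context {R : realType} {A : wstarType R} {E : wcorrType A} (F : fock E).
Local Notation FE := (fock_space F).

Definition creation (x : E) : FE -> FE :=
  xget (fun=> 0) [set T | adjointable T /\
    forall n (xi : fock_pow F n), T (fock_inj xi) = fock_inj (fock_tensor x xi)].

Definition Hardy : set (FE -> FE) :=
  wclosure (@adjointable R A FE FE) (@LM_predual R A FE)
    (alg_gen (range (@lact R A FE) `|` range creation)).

Definition alg_hom_on (V W : lmodType R[i]) (D : set (V -> V))
    (rho : (V -> V) -> (W -> W)) : Prop :=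
  (forall (c : R[i]) X Y, D X -> D Y -> rho (c *: X + Y) = c *: rho X + rho Y) /\
  (forall X Y, D X -> D Y -> rho (X \o Y) = rho X \o rho Y).

Definition completely_isometric (alpha : (FE -> FE) -> (FE -> FE)) : Prop :=
  forall n (X : 'I_n -> 'I_n -> FE -> FE), (forall i j, Hardy (X i j)) ->
    mx_opnorm (@mvec_norm R A FE n) (@mvec_norm R A FE n)
      (fun i j => alpha (X i j)) =
    mx_opnorm (@mvec_norm R A FE n) (@mvec_norm R A FE n) X.

Definition Aut_Hardy (alpha : (FE -> FE) -> (FE -> FE)) : Prop :=
  [/\ alg_hom_on Hardy alpha,
      completely_isometric alpha,
      (forall a : A, alpha (lact a) = lact a) &
      exists beta : (FE -> FE) -> (FE -> FE),
        [/\ set_fun Hardy Hardy alpha, set_fun Hardy Hardy beta,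
            {in Hardy, cancel alpha beta}, {in Hardy, cancel beta alpha} &
            wcontinuous Hardy (@LM_predual R A FE) (@LM_predual R A FE) alpha /\
            wcontinuous Hardy (@LM_predual R A FE) (@LM_predual R A FE) beta]].

Context {H : hilbertType R} {sigma : A -> H -> H}.
Variable K : interior_tensor E sigma.

Definition completely_contractive (rho : (FE -> FE) -> (H -> H)) : Prop :=
  forall n (X : 'I_n -> 'I_n -> FE -> FE), (forall i j, Hardy (X i j)) ->
    mx_opnorm (@hvec_norm R H n) (@hvec_norm R H n) (fun i j => rho (X i j)) <=
    mx_opnorm (@mvec_norm R A FE n) (@mvec_norm R A FE n) X.

(* [rho] is the representation [sigma x eta] of the Hardy algebra. *)
Definition is_integrated (eta : K -> H) (rho : (FE -> FE) -> (H -> H)) : Prop :=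
  [/\ (forall X, Hardy X -> bounded_linear (rho X)),
      alg_hom_on Hardy rho,
      wcontinuous Hardy (@LM_predual R A FE) (@BH_predual R H) rho,
      completely_contractive rho &
      (forall a : A, rho (lact a) = sigma a) /\
      (forall x : E, rho (creation x) = fun h => eta (tensor K x h))].

Definition hat (X : FE -> FE) (eta : K -> H) : H -> H :=
  xget (fun=> fun=> 0) [set rho | is_integrated eta rho] X.

Definition implements (g : (K -> H) -> (K -> H))
    (alpha : (FE -> FE) -> (FE -> FE)) : Prop :=
  forall X eta, Hardy X -> ball_EsigmaS eta ->
    hat (alpha X) eta = hat X (g eta).

End Hardy.

(* Main.v *)
(* With [C := (I - eta gamma) Delta^-1], the row on the left is
   [(C, C g(eta))], so it represents the class of [(I, g(eta))] as soon as [C]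
   is an invertible element of the commutant of [sigma(A)].  Invertibility comes
   from the Neumann series, [eta] and [gamma] being strict contractions.  For
   the commutant, it is enough to commute with [sigma(a)] for [a] self-adjoint,
   where [phi(a) (x) I] is its own adjoint; this gives [gamma^* gamma] and
   [eta gamma], and [Delta] follows since the positive square root of
   [I - gamma^* gamma] is unique and a norm limit of polynomials in it. *)
Require Import Defs.
From HB Require Import structures.
From mathcomp Require Import all_boot all_order all_algebra.
From mathcomp Require Import all_classical reals topology normedtype.
From mathcomp Require Import sequences.
From mathcomp Require Import complex lra.
Set Implicit Arguments.
Unset Strict Implicit.
Unset Printing Implicit Defensive.
Import Order.TTheory GRing.Theory Num.Theory numFieldNormedType.Exports.
Local Open Scope classical_set_scope.
Local Open Scope ring_scope.

(** * Real-valued norms and geometric convergence *)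

Section RealNorm.
Context {R : realType}.
Implicit Types V : normedModType R[i].

Lemma normE V (x : V) : `|x| = (nrm x)%:C%C.
Proof. by rewrite /nrm RRe_real // ger0_real. Qed.

Lemma nrm_ge0 V (x : V) : 0 <= nrm x.
Proof. by rewrite -lecR -normE; exact: normr_ge0. Qed.

Lemma nrmD V (x y : V) : nrm (x + y) <= nrm x + nrm y.
Proof. by rewrite -lecR rmorphD/= -!normE ler_normD. Qed.

Lemma nrmN V (x : V) : nrm (- x) = nrm x.
Proof. by rewrite /nrm normrN. Qed.

Lemma nrm_distC V (x y : V) : nrm (x - y) = nrm (y - x).
Proof. by rewrite -nrmN opprB. Qed.

Lemma nrm0 V : nrm (0 : V) = 0.
Proof. by rewrite /nrm normr0. Qed.

Lemma nrm0_eq0 V (x : V) : nrm x = 0 -> x = 0.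
Proof. by move=> x0; apply/normr0_eq0; rewrite normE x0. Qed.

Lemma nrm_half V (x : V) : nrm (2^-1 *: x) = 2^-1 * nrm x.
Proof.
apply: (@complexI R); rewrite rmorphM/= -!normE normrZ; congr (_ * _).
by rewrite ger0_norm ?invr_ge0 ?ler0n // fmorphV/= rmorph_nat.
Qed.

Lemma nrm_tri V (x y z : V) : nrm (x - z) <= nrm (x - y) + nrm (y - z).
Proof. by rewrite (le_trans _ (nrmD _ _)) // addrA subrK. Qed.

Lemma cvg_geometric0 (M q : R) : 0 <= q -> q < 1 ->
  forall e, 0 < e -> exists n, M * q ^+ n < e.
Proof.
move=> q0 q1 e e0.
have := @cvg_geometric R M q; rewrite ger0_norm // => /(_ q1) /cvgrPdist_lt.
move=> /(_ e e0) [n _ /(_ n (leqnn n))]; rewrite sub0r normrN => Mn.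
by exists n; rewrite (le_lt_trans (ler_norm _)).
Qed.

(** Identities between limits are proved below through this lemma: the difference of the two sides
    is estimated at every stage [n] of an iteration. *)
Lemma eq0_geometric V (x : V) (M q : R) : 0 <= q -> q < 1 ->
  (forall n, nrm x <= M * q ^+ n) -> x = 0.
Proof.
move=> q0 q1 xM; apply: nrm0_eq0; apply/eqP; rewrite eq_le nrm_ge0 andbT.
rewrite leNgt; apply/negP => /(cvg_geometric0 M q0 q1)[n].
by rewrite ltNge xM.
Qed.

Lemma geometric_limit (V : completeNormedModType R[i]) (u : nat -> V) (M q : R) :
  0 <= q -> q < 1 -> (forall n, nrm (u n.+1 - u n) <= M * q ^+ n) ->
  exists l, forall n, nrm (l - u n) <= M / (1 - q) * q ^+ n.
Proof.
move=> q0 q1 uM.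
have q10 : 0 < 1 - q by rewrite subr_gt0.
set C := M / (1 - q).
(* [C] sums the series [M * q ^+ n]. Written this way, each step bound is a difference
   [C * q ^+ n - C * q ^+ n.+1], so the bounds telescope in [tail]. *)
have CM : M = C - C * q by rewrite -{1}[C]mulr1 -mulrBr mulfVK // gt_eqF.
have C0 : 0 <= C.
  apply: divr_ge0; last exact: ltW.
  by have := le_trans (nrm_ge0 _) (uM 0%N); rewrite expr0 mulr1.
have tail n k : nrm (u (n + k)%N - u n) <= C * q ^+ n - C * q ^+ (n + k).
  elim: k => [|k IH]; first by rewrite addn0 !subrr nrm0.
  rewrite addnS; apply: le_trans (nrm_tri _ (u (n + k)%N) _) _.
  have := lerD (uM (n + k)%N) IH.
  by rewrite {1}CM exprS mulrBl -mulrA; lra.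
have bound n m : (n <= m)%N -> nrm (u m - u n) <= C * q ^+ n.
  move=> nm; rewrite -(subnKC nm); apply: le_trans (tail _ _) _.
  by rewrite gerBl mulr_ge0 // exprn_ge0.
have [l ul] : exists l : V, u @ \oo --> l.
  suff /cauchy_cvgP uc : cauchy (u @ \oo) by exists (lim (u @ \oo)).
  apply: cauchy_exP => e e0.
  have er : e = (complex.Re e)%:C%C by rewrite RRe_real // gtr0_real.
  have : 0 < complex.Re e by rewrite -ltcR -er.
  move=> /(cvg_geometric0 C q0 q1)[n Cn].
  exists (u n); exists n => // m /= nm.
  rewrite -ball_normE /= normE er ltcR nrm_distC.
  by apply: le_lt_trans (bound _ _ nm) _.
exists l => n; apply/ler_addgt0Pr => e e0.
have e0' : 0 < e%:C%C :> R[i] by rewrite ltcR.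
move/cvgrPdist_lt : ul => /(_ _ e0')[m _ /(_ (maxn m n))].
rewrite /= leq_maxl => /(_ isT); rewrite normE ltcR => lu.
apply: le_trans (nrm_tri _ (u (maxn m n)) _) _.
by rewrite addrC lerD // ?(ltW lu) // bound // leq_maxr.
Qed.

End RealNorm.

(** * Bounded linear maps and the Neumann series *)

Section BoundedLinear.
Context {R : realType}.
Implicit Types U V W : normedModType R[i].

Section Linear.
Context {U V : normedModType R[i]} {f : U -> V} (lf : linear f).

Lemma lin0 : f 0 = 0.
Proof. by have := lf (-1) 0 0; rewrite !scaleN1r oppr0 addr0 addNr. Qed.

Lemma linD x y : f (x + y) = f x + f y.
Proof. by have := lf 1 x y; rewrite !scale1r. Qed.

Lemma linZ c x : f (c *: x) = c *: f x.
Proof. by have := lf c x 0; rewrite lin0 !addr0. Qed.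

Lemma linN x : f (- x) = - f x.
Proof. by rewrite -scaleN1r linZ scaleN1r. Qed.

Lemma linB x y : f (x - y) = f x - f y.
Proof. by rewrite linD linN. Qed.

End Linear.

Lemma bounded_pos U V (f : U -> V) : bounded_linear f ->
  exists2 c : R, 0 <= c & forall x, nrm (f x) <= c * nrm x.
Proof.
move=> [_ [c fc]]; exists `|c| => // x; apply: le_trans (fc x) _.
by rewrite ler_wpM2r ?nrm_ge0 // ler_norm.
Qed.

Lemma opnorm_lt U V (f : U -> V) (e : R) : bounded_linear f -> opnorm f < e ->
  exists2 c : R, 0 <= c < e & forall x, nrm (f x) <= c * nrm x.
Proof.
move=> /bounded_pos[c c0 fc] fe.
have [|d [d0 fd] de] := inf_lt _ fe; last by exists d; rewrite ?d0.
by exists c.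
Qed.

Lemma bounded_linear_id U : bounded_linear (@idfun U).
Proof. by split; [|exists 1 => x; rewrite mul1r]. Qed.

Lemma bounded_linear_comp U V W (f : V -> W) (g : U -> V) :
  bounded_linear f -> bounded_linear g -> bounded_linear (f \o g).
Proof.
move=> bf bg; split => [c x y/=|]; first by rewrite bg.1 bf.1.
have [c c0 fc] := bounded_pos bf; have [d d0 gd] := bounded_pos bg.
exists (c * d) => x /=; apply: le_trans (fc _) _.
by rewrite -mulrA ler_wpM2l.
Qed.

Lemma bounded_linearB U V (f g : U -> V) :
  bounded_linear f -> bounded_linear g -> bounded_linear (f - g).
Proof.
move=> [lf [c fc]] [lg [d gd]]; split => [k x y|].
  by rewrite !fctE lf lg scalerBr opprD addrACA.
exists (c + d) => x; rewrite mulrDl; apply: le_trans (nrmD _ _) _.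
by rewrite nrmN lerD.
Qed.

Lemma inverse_opP U V (f : U -> V) : invertible_op f ->
  is_inverse f (inverse_op f).
Proof.
move=> [f' ff'].
by apply: (@xgetPex _ _ [set f' | is_inverse f f']); exists f'.
Qed.

Lemma is_inverse_comp U V W (f : V -> W) (g : U -> V) f' g' :
  is_inverse f f' -> is_inverse g g' -> is_inverse (f \o g) (g' \o f').
Proof.
move=> [bf fK fK'] [bg gK gK']; split; first exact: bounded_linear_comp.
- exact: can_comp.
- exact: can_comp.
Qed.

(** [idfun - Z] is bounded below by [1 - q], which gives injectivity and the bound on the inverse.
    Surjectivity comes from iterating the contraction [x |-> y + Z x] from 0; the iterates are the
    partial sums of the Neumann series at [y]. *)
Lemma neumann (V : completeNormedModType R[i]) (Z : V -> V) (q : R) :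
  bounded_linear Z -> 0 <= q -> q < 1 -> (forall x, nrm (Z x) <= q * nrm x) ->
  invertible_op (idfun - Z).
Proof.
move=> [lZ _] q0 q1 Zq.
have lB : linear (idfun - Z).
  by move=> c x y; rewrite !fctE lZ scalerBr opprD addrACA.
have below x : (1 - q) * nrm x <= nrm ((idfun - Z) x).
  rewrite !fctE mulrBl mul1r lerBlDr -{1}[x](subrK (Z x)).
  by apply: le_trans (nrmD _ _) _; rewrite lerD2l.
have onto y : exists x, (idfun - Z) x = y.
  pose u n := iter n (fun x : V => y + Z x) 0.
  have uS n : u n.+1 = y + Z (u n) by [].
  have du n : nrm (u n.+1 - u n) <= nrm y * q ^+ n.
    elim: n => [|n IH]; first by rewrite /= (lin0 lZ) addr0 subr0 expr0 mulr1.
    rewrite !uS opprD addrACA subrr add0r -uS -(linB lZ) exprS.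
    by apply: le_trans (Zq _) _; rewrite mulrCA ler_wpM2l.
  have [x xu] := geometric_limit q0 q1 du.
  exists x; apply/eqP; rewrite !fctE -subr_eq0; apply/eqP.
  (* Since [u n.+1 = y + Z (u n)], the residual splits into [x - u n.+1] and [Z (u n - x)]. Each is
     at most [C * q ^+ n], whence the factor 2. *)
  apply: (@eq0_geometric _ _ _ (2 * (nrm y / (1 - q))) q) => // n.
  have -> : x - Z x - y = (x - u n.+1) + Z (u n - x).
    by rewrite uS (linB lZ) opprD !addrA subrK addrAC.
  set C := nrm y / (1 - q) in xu *.
  have h1 := xu n.+1; have h2 := xu n.
  have C0 : 0 <= C * q ^+ n := le_trans (nrm_ge0 _) h2.
  apply: le_trans (nrmD _ _) _.
  have := Zq (u n - x); rewrite nrm_distC => h3.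
  move: h1; rewrite exprS mulrCA => h1.
  have : q * nrm (x - u n) <= q * (C * q ^+ n) by rewrite ler_wpM2l.
  have : q * (C * q ^+ n) <= C * q ^+ n by rewrite ler_piMl // ltW.
  rewrite nrm_distC in h3.
  move: h1 h3; rewrite nrm_distC; lra.
have inj x y : (idfun - Z) x = (idfun - Z) y -> x = y.
  move=> xy; apply/eqP; rewrite -subr_eq0; apply/eqP/nrm0_eq0/eqP.
  rewrite eq_le nrm_ge0 andbT -(pmulr_rle0 _ (_ : 0 < 1 - q)) ?subr_gt0 //.
  by apply: le_trans (below _) _; rewrite (linB lB) xy subrr nrm0.
have [f fK] := choice onto.
exists f; split => //; last by move=> x; apply: inj.
split=> [c x y|]; first by apply: inj; rewrite lB !fK.
exists (1 - q)^-1 => x; rewrite mulrC ler_pdivlMr ?subr_gt0 // mulrC.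
by apply: le_trans (below _) _; rewrite fK.
Qed.

End BoundedLinear.

(** * Inner products, adjoints and density *)

Section HilbertSpace.
Context {R : realType}.
Implicit Types H K : hilbertType R.

Lemma innerDr H (x y z : H) : inner x (y + z) = inner x y + inner x z.
Proof. by have := inner_linear x 1 y z; rewrite !scale1r. Qed.

Lemma inner0r H (x : H) : inner x 0 = 0.
Proof. by apply: (addIr (inner x 0)); rewrite -innerDr !add0r. Qed.

Lemma inner0l H (x : H) : inner 0 x = 0.
Proof. by rewrite -inner_conj inner0r rmorph0. Qed.

Lemma innerZr H (x y : H) c : inner x (c *: y) = c * inner x y.
Proof. by have := inner_linear x c y 0; rewrite !addr0 inner0r addr0. Qed.

Lemma innerNr H (x y : H) : inner x (- y) = - inner x y.
Proof. by rewrite -scaleN1r innerZr mulN1r. Qed.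

Lemma innerBr H (x y z : H) : inner x (y - z) = inner x y - inner x z.
Proof. by rewrite innerDr innerNr. Qed.

Lemma innerDl H (x y z : H) : inner (x + y) z = inner x z + inner y z.
Proof. by rewrite -[LHS]inner_conj innerDr rmorphD/= !inner_conj. Qed.

Lemma innerNl H (x y : H) : inner (- x) y = - inner x y.
Proof. by rewrite -[LHS]inner_conj innerNr rmorphN/= !inner_conj. Qed.

Lemma innerBl H (x y z : H) : inner (x - y) z = inner x z - inner y z.
Proof. by rewrite innerDl innerNl. Qed.

Lemma innerZl H (x y : H) c : inner (c *: x) y = Num.conj c * inner x y.
Proof. by rewrite -[LHS]inner_conj innerZr rmorphM/= !inner_conj. Qed.

Lemma innerxx H (x : H) : inner x x = (nrm x ^+ 2)%:C%C.
Proof. by rewrite inner_norm normE rmorphXn. Qed.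

Lemma inner_eqr H (x y : H) : (forall z, inner z x = inner z y) -> x = y.
Proof.
move=> xy; apply/eqP; rewrite -subr_eq0; apply/eqP/normr0_eq0/eqP.
by rewrite -sqrf_eq0 -inner_norm innerBr xy subrr.
Qed.

Lemma cauchy_schwarz H (x y : H) : `|inner x y| <= (nrm x * nrm y)%:C%C.
Proof.
have [->|y0] := eqVneq y 0; first by rewrite inner0r normr0 nrm0 mulr0.
rewrite -(@ler_pXn2r _ 2) ?nnegrE // ?lecR ?mulr_ge0 ?nrm_ge0 //.
have -> : (nrm x * nrm y)%:C%C ^+ 2 = inner x x * inner y y.
  by rewrite !innerxx !rmorphXn/= rmorphM exprMn.
have yy : 0 < inner y y by rewrite inner_norm exprn_gt0 // normr_gt0.
(* [c *: y] is the orthogonal projection of [x] on the line of [y]; the inequality is the positivity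
   of the squared norm of [x - c *: y], multiplied by [inner y y]. *)
set c := inner y x / inner y y.
have : 0 <= inner (x - c *: y) (x - c *: y) by rewrite inner_norm exprn_ge0.
have cE : c * inner y y = inner y x by rewrite /c mulfVK // gt_eqF.
rewrite innerBl innerZl !innerBr !innerZr cE subrr mulr0 subr0 subr_ge0.
rewrite -(ler_pM2r yy) mulrAC cE; apply: le_trans.
by rewrite normCK inner_conj mulrC.
Qed.

Lemma is_adjoint_sym H K (f : H -> K) f' : is_adjoint f f' -> is_adjoint f' f.
Proof. by move=> ff' x y; rewrite -inner_conj -ff' inner_conj. Qed.

(** Cauchy-Schwarz bounds the squared norm of [f' y], which equals [inner (f (f' y)) y], by
    [c * nrm (f' y) * nrm y]; then one factor [nrm (f' y)] is cancelled. *)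
Lemma adjoint_bound H K (f : H -> K) f' (c : R) : is_adjoint f f' -> 0 <= c ->
  (forall x, nrm (f x) <= c * nrm x) -> forall y, nrm (f' y) <= c * nrm y.
Proof.
move=> ff' c0 fc y; have [->|f0] := eqVneq (nrm (f' y)) 0.
  by rewrite mulr_ge0 ?nrm_ge0.
have fp : 0 < nrm (f' y) by rewrite lt_neqAle eq_sym f0 nrm_ge0.
rewrite -(ler_pM2r fp) -expr2 -lecR -innerxx -ff'.
have := cauchy_schwarz (f (f' y)) y.
rewrite ger0_norm ?ff' ?innerxx ?lecR ?exprn_ge0 ?nrm_ge0 // => /le_trans; apply.
by rewrite mulrAC ler_wpM2r ?nrm_ge0.
Qed.

(** Asking for compatibility with subtraction instead of linearity lets this apply to both variables
    of a sesquilinear form, one of which is conjugate-linear. *)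
Lemma dense_eq0 H (D : set H) (f : H -> R[i]) (c : R) : dense D ->
  {morph f : x y / x - y} -> (forall x, `|f x| <= (c * nrm x)%:C%C) ->
  (forall x, D x -> f x = 0) -> forall x, f x = 0.
Proof.
move=> dD fB fc f0 x; apply/eqP; rewrite -normr_le0.
apply/ler_addgt0Pr => e e0; rewrite add0r.
have er : e = (complex.Re e)%:C%C by rewrite RRe_real // gtr0_real.
have ep : 0 < complex.Re e by rewrite -ltcR -er.
(* The [+ 1] keeps the radius well defined and positive when [c = 0]. *)
pose d := complex.Re e / (`|c| + 1).
have c1 : 0 < `|c| + 1 by rewrite ltr_wpDl.
have dp : 0 < d%:C%C :> R[i] by rewrite ltcR divr_gt0.
have [y []] : ball x d%:C%C `&` D !=set0.
  by apply: dD; [exists x; exact: ballxx | exact: ball_open].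
rewrite -ball_normE /= normE ltcR => xy /f0 fy.
have -> : f x = f (x - y) by rewrite fB fy subr0.
apply: le_trans (fc _) _; rewrite er lecR.
have : (`|c| + 1) * nrm (x - y) <= complex.Re e.
  by rewrite -ler_pdivlMl // mulrC ltW.
apply: le_trans; rewrite ler_wpM2r ?nrm_ge0 //.
by rewrite (le_trans (ler_norm c)) // lerDl.
Qed.

End HilbertSpace.

(* For a bound [q < 1] on [T], the iteration [X = (T + X^2) / 2] contracts the
   ball of radius [q] and [1 - lim X] is a square root of [1 - T]. *)
Section SquareRoot.
Context {R : realType} {H : hilbertType R} (T : H -> H) (q : R).
Hypotheses (bT : bounded_linear T) (q0 : 0 <= q) (q1 : q < 1).
Hypotheses (Tq : forall x, nrm (T x) <= q * nrm x) (Tsa : is_adjoint T T).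

Fixpoint sqrt_iter (n : nat) : H -> H :=
  if n is n'.+1 then fun x => 2^-1 *: (T x + sqrt_iter n' (sqrt_iter n' x))
  else fun=> 0.

Lemma sqrt_iter_linear n : linear (sqrt_iter n).
Proof.
elim: n => [|n IH] c x y /=; first by rewrite scaler0 addr0.
rewrite bT.1 !IH addrACA -[c *: T x + _]scalerDr [LHS]scalerDr.
by rewrite !scalerA mulrC.
Qed.

Lemma sqrt_iter_bound n x : nrm (sqrt_iter n x) <= q * nrm x.
Proof.
elim: n x => [|n IH] x /=; first by rewrite nrm0 mulr_ge0 ?nrm_ge0.
rewrite nrm_half.
have := nrmD (T x) (sqrt_iter n (sqrt_iter n x)).
have := Tq x; have := IH (sqrt_iter n x).
have : q * nrm (sqrt_iter n x) <= q * nrm x.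
  by rewrite ler_wpM2l // (le_trans (IH x)) // ler_piMl ?nrm_ge0 // ltW.
lra.
Qed.

Lemma sqrt_iter_step n x :
  nrm (sqrt_iter n.+1 x - sqrt_iter n x) <= q * nrm x * q ^+ n.
Proof.
elim: n x => [|n IH] x.
  by rewrite subr0 expr0 mulr1 sqrt_iter_bound.
set X := sqrt_iter n.+1; set Y := sqrt_iter n.
(* This is [X^2 - Y^2 = X (X - Y) + (X - Y) Y]. The first summand gains a factor [q] from the bound
   on [X], the second from the induction hypothesis at [Y x]; the factor one half averages the
   two. *)
have -> : sqrt_iter n.+2 x - X x = 2^-1 *: (X (X x - Y x) + (X (Y x) - Y (Y x))).
  have lX : linear X := sqrt_iter_linear n.+1.
  rewrite (linB lX) addrA subrK.
  have -> : sqrt_iter n.+2 x - X x =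
    2^-1 *: (T x + X (X x)) - 2^-1 *: (T x + Y (Y x)) by [].
  by rewrite -scalerBr opprD addrACA subrr add0r.
rewrite nrm_half exprS.
have := nrmD (X (X x - Y x)) (X (Y x) - Y (Y x)).
have := sqrt_iter_bound n.+1 (X x - Y x).
have : q * nrm (X x - Y x) <= q * (q * nrm x * q ^+ n) by rewrite ler_wpM2l.
have := IH (Y x).
have : q * nrm (Y x) * q ^+ n <= q * (q * nrm x) * q ^+ n.
  by rewrite ler_wpM2r ?exprn_ge0 // ler_wpM2l // sqrt_iter_bound.
rewrite -/X -/Y; lra.
Qed.

Lemma sqrt_iter_adjoint n : is_adjoint (sqrt_iter n) (sqrt_iter n).
Proof.
elim: n => [|n IH] x y /=.
  by rewrite inner0r inner0l.
rewrite innerZl innerZr innerDl innerDr Tsa !IH; congr (_ * _).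
by rewrite fmorphV/= rmorph_nat.
Qed.

Lemma sqrt_iter_comm (B : H -> H) n : bounded_linear B ->
  (forall x, T (B x) = B (T x)) -> forall x, sqrt_iter n (B x) = B (sqrt_iter n x).
Proof.
move=> [lB _] TB; elim: n => [|n IH] x /=; first by rewrite (lin0 lB).
by rewrite TB !IH -(linD lB) (linZ lB).
Qed.

Lemma sqrt_limit : exists X : H -> H, forall x n,
  nrm (X x - sqrt_iter n x) <= q / (1 - q) * nrm x * q ^+ n.
Proof.
have lim x := geometric_limit q0 q1 (sqrt_iter_step^~ x).
have [X XP] := choice lim; exists X => x n.
by rewrite [q / _ * _]mulrAC.
Qed.

(** Each property holds for the iterates, exactly or up to a geometric error, and passes to the
    limit. The relation [2 X = T + X^2] says that [1 - X] squares to [1 - T], and the last clause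
    carries commutation from [T] to its square root. *)
Lemma sqrt_exists : exists X : H -> H,
  [/\ bounded_linear X, (forall x, nrm (X x) <= q * nrm x),
      is_adjoint X X, (forall x, X x + X x = T x + X (X x)) &
      forall B : H -> H, bounded_linear B -> (forall x, T (B x) = B (T x)) ->
        forall x, X (B x) = B (X x)].
Proof.
have [X XP] := sqrt_limit.
set C := q / (1 - q) in XP.
have C0 : 0 <= C by rewrite divr_ge0 // subr_ge0 ltW.
have close x y (M : R) : (forall n, nrm (x - y) <= M * q ^+ n) -> x = y :> H.
  by move=> xM; apply/subr0_eq; exact: eq0_geometric q0 q1 xM.
have Xq x : nrm (X x) <= q * nrm x.
  apply/ler_addgt0Pr => e /(cvg_geometric0 (C * nrm x) q0 q1)[n Cn].
  rewrite -[X x](subrK (sqrt_iter n x)) addrC.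
  apply: le_trans (nrmD _ _) _; rewrite lerD ?sqrt_iter_bound //.
  exact: le_trans (XP x n) (ltW Cn).
have comm (B : H -> H) : bounded_linear B -> (forall x, T (B x) = B (T x)) ->
    forall x, X (B x) = B (X x).
  move=> bB TB x; have [b b0 Bb] := bounded_pos bB.
  apply: (close _ _ (C * nrm (B x) + b * (C * nrm x))) => n.
  apply: le_trans (nrm_tri _ (sqrt_iter n (B x)) _) _.
  rewrite mulrDl lerD // sqrt_iter_comm // -(linB bB.1).
  apply: le_trans (Bb _) _; rewrite nrm_distC -mulrA ler_wpM2l //.
have lX : linear X.
  move=> c x y; pose c' := complex.Re `|c|.
  have nZ (z : H) : nrm (c *: z) = c' * nrm z.
    apply: (@complexI R); rewrite rmorphM/= -!normE normrZ.
    by rewrite RRe_real // ger0_real.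
  apply: (close _ _ (C * nrm (c *: x + y) + (c' * (C * nrm x) + C * nrm y))) => n.
  apply: le_trans (nrm_tri _ (sqrt_iter n (c *: x + y)) _) _.
  rewrite mulrDl lerD // sqrt_iter_linear opprD addrACA -scalerBr.
  apply: le_trans (nrmD _ _) _; rewrite nZ mulrDl lerD //.
    rewrite -[leRHS]mulrA nrm_distC ler_wpM2l //.
    by rewrite -lecR /c' RRe_real ?normr_real //; exact: normr_ge0.
  by rewrite nrm_distC.
exists X; split => //.
- by split => //; exists q.
- move=> x y; apply/eqP; rewrite -subr_eq0 -normr_le0.
  apply/ler_addgt0Pr => e e0; rewrite add0r.
  have er : e = (complex.Re e)%:C%C by rewrite RRe_real // gtr0_real.
  have ep : 0 < complex.Re e by rewrite -ltcR -er.
  have [n Cn] := cvg_geometric0 (2 * (C * (nrm x * nrm y))) q0 q1 ep.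
  have -> : inner (X x) y - inner x (X y) =
      inner (X x - sqrt_iter n x) y - inner x (X y - sqrt_iter n y).
    by rewrite innerBl innerBr sqrt_iter_adjoint opprB addrA subrK.
  apply: le_trans (ler_normB _ _) _.
  apply: le_trans (lerD (cauchy_schwarz _ _) (cauchy_schwarz _ _)) _.
  rewrite -rmorphD/= er lecR; apply: le_trans (ltW Cn).
  have : nrm (X x - sqrt_iter n x) * nrm y <= C * nrm x * q ^+ n * nrm y.
    by rewrite ler_wpM2r ?nrm_ge0.
  have : nrm x * nrm (X y - sqrt_iter n y) <= nrm x * (C * nrm y * q ^+ n).
    by rewrite ler_wpM2l ?nrm_ge0.
  lra.
- move=> x; apply: (close _ _ (2 * C * nrm x * q + 2 * (q * C * nrm x))) => n.
  set Y := sqrt_iter n; have lY : linear Y := sqrt_iter_linear n.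
  (* The recursion gives exactly [2 X_(n+1) x = T x + Y (Y x)] with [Y = X_n]. What remains is twice
     the error at stage [n.+1] plus [Y (Y x) - X (X x)], split so that each piece contains one error
     at stage [n]. *)
  have -> : X x + X x - (T x + X (X x)) =
      ((X x - sqrt_iter n.+1 x) + (X x - sqrt_iter n.+1 x)) +
      (Y (Y x - X x) + (Y (X x) - X (X x))).
    have -> : Y (Y x - X x) + (Y (X x) - X (X x)) = Y (Y x) - X (X x).
      by rewrite (linB lY) addrA subrK.
    have YE : sqrt_iter n.+1 x + sqrt_iter n.+1 x = T x + Y (Y x).
      by rewrite -mulr2n -scaler_nat /= scalerA divff ?pnatr_eq0 // scale1r.
    rewrite [X x - _ + _]addrACA -[- _ - sqrt_iter _ _]opprD YE !opprD !addrA.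
    by rewrite subrK.
  apply: le_trans (nrmD _ _) _.
  have h1 := XP x n.+1; have h2 := XP x n; have h3 := XP (X x) n.
  have h4 : nrm (Y (Y x - X x)) <= q * nrm (X x - Y x).
    by rewrite nrm_distC; exact: sqrt_iter_bound.
  have h5 : q * nrm (X x - Y x) <= q * (C * nrm x * q ^+ n) by rewrite ler_wpM2l.
  have h6 : C * nrm (X x) * q ^+ n <= C * (q * nrm x) * q ^+ n.
    by rewrite ler_wpM2r ?exprn_ge0 // ler_wpM2l.
  have := nrmD (X x - sqrt_iter n.+1 x) (X x - sqrt_iter n.+1 x).
  have := nrmD (Y (Y x - X x)) (Y (X x) - X (X x)).
  rewrite exprS in h1; rewrite (nrm_distC _ (X (X x))).
  rewrite -/Y in h2 h3 *; lra.
Qed.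

(** [sqrt_op] picks some positive square root [S], so its properties come from uniqueness: [S] is
    shown to be [Q = 1 - X], with [X] the limit built above. Then [neumann] gives invertibility. *)
Lemma sqrt_op_spec : [/\ bounded_linear (sqrt_op (idfun - T)),
  invertible_op (sqrt_op (idfun - T)) &
  forall B : H -> H, bounded_linear B -> (forall x, T (B x) = B (T x)) ->
    forall x, sqrt_op (idfun - T) (B x) = B (sqrt_op (idfun - T) x)].
Proof.
have [X [bX Xq Xsa XE Xcomm]] := sqrt_exists.
pose Q := idfun - X; have QE x : Q x = x - X x by [].
have bQ : bounded_linear Q := bounded_linearB (bounded_linear_id _) bX.
(* Coercivity of [Q]: self-adjointness of [X] makes [inner x (X x)] real, and Cauchy-Schwarz bounds
   it by [q * nrm x ^+ 2]. *)
have Q_ge x : ((1 - q) * nrm x ^+ 2)%:C%C <= inner x (Q x).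
  rewrite QE innerBr innerxx mulrBl mul1r rmorphB/= lerD2l lerN2.
  have re : inner x (X x) \is Num.real by rewrite CrealE inner_conj Xsa.
  apply: le_trans (real_ler_norm re) _; apply: le_trans (cauchy_schwarz _ _) _.
  by rewrite lecR mulrC expr2 mulrA ler_wpM2r ?nrm_ge0.
have Qpos : positive_op Q.
  move=> x; apply: le_trans (Q_ge x).
  by rewrite lecR mulr_ge0 ?exprn_ge0 ?nrm_ge0 // subr_ge0 ltW.
have QQ : Q \o Q = idfun - T.
  apply/funext => x; rewrite /= !QE (linB bX.1) opprB.
  have -> : X (X x) = X x + X x - T x by rewrite XE addrC addKr.
  by rewrite [X x + X x - T x]addrAC addrK addrA subrK.
have [bS Spos SS] : [/\ bounded_linear (sqrt_op (idfun - T)),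
    positive_op (sqrt_op (idfun - T)) &
    sqrt_op (idfun - T) \o sqrt_op (idfun - T) = idfun - T].
  by apply: (@xgetPex _ _ [set s | [/\ bounded_linear s, positive_op s &
    s \o s = idfun - T]]); exists Q.
set S := sqrt_op _ in bS Spos SS *.
(* [T = 1 - S^2] commutes with [S], hence so do [X] and [Q]; this is what allows [S^2 - Q^2] to be
   factored. *)
have TS x : T (S x) = S (T x).
  have TE y : T y = y - S (S y).
    by rewrite -[S (S y)]/((S \o S) y) SS !fctE opprB addrC subrK.
  by rewrite !TE (linB bS.1).
have QS x : Q (S x) = S (Q x) by rewrite !QE Xcomm // (linB bS.1).
(* [(S + Q)(S - Q) = 0] and [S + Q] is coercive. *)
have SQ : S = Q.
  apply/funext => x; apply/subr0_eq; set d := S x - Q x.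
  have d0 : inner d (S d) + inner d (Q d) = 0.
    rewrite -innerDr (linB bS.1) (linB bQ.1) QS addrA subrK.
    rewrite -[S (S x)]/((S \o S) x) -[Q (Q x)]/((Q \o Q) x) SS QQ subrr.
    exact: inner0r.
  have : inner d (Q d) <= 0 by rewrite -d0 lerDr Spos.
  move=> /(le_trans (Q_ge d)); rewrite lecR pmulr_rle0 ?subr_gt0 // => dd.
  apply: nrm0_eq0; apply/eqP; rewrite -sqrf_eq0 eq_le dd.
  by rewrite exprn_ge0 ?nrm_ge0.
rewrite SQ; split => //; first exact: neumann bX q0 q1 Xq.
by move=> B bB TB x; rewrite !QE Xcomm // (linB bB.1).
Qed.

End SquareRoot.

(** * The commutant of the representation *)

Section Commutant.
Context {R : realType} {A : wstarType R} {H : hilbertType R}.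
Context {sigma : A -> H -> H} (sigma_rep : normal_rep sigma).

Lemma commutant_id : rep_commutant sigma idfun.
Proof. by split; [exact: bounded_linear_id|]. Qed.

Lemma commutant_comp b c : rep_commutant sigma b -> rep_commutant sigma c ->
  rep_commutant sigma (b \o c).
Proof.
move=> [bb bs] [bc cs]; split; first exact: bounded_linear_comp.
by move=> a; rewrite -compA cs compA bs.
Qed.

Lemma commutantB b c : rep_commutant sigma b -> rep_commutant sigma c ->
  rep_commutant sigma (b - c).
Proof.
move=> [bb bs] [bc cs]; split; first exact: bounded_linearB.
have [bsig _ _ _ _] := sigma_rep.
move=> a; apply/funext => h.
have := congr1 (@^~ h) (bs a); have := congr1 (@^~ h) (cs a).
by rewrite /= !fctE (linB (bsig a).1) => -> ->.
Qed.

Lemma commutant_inverse b b' : rep_commutant sigma b -> is_inverse b b' ->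
  rep_commutant sigma b'.
Proof.
move=> [_ bs] [bb' bK b'K]; split => // a; apply/funext => h /=.
have := congr1 (@^~ (b' h)) (bs a); rewrite /= b'K => <-.
by rewrite bK.
Qed.

(* Every [a] is [Re a + i Im a] with self-adjoint real and imaginary parts. *)
Lemma commutant_selfadj b : bounded_linear b ->
  (forall a, star a = a -> forall h, b (sigma a h) = sigma a (b h)) ->
  rep_commutant sigma b.
Proof.
move=> bb bs; split => // a; apply/funext => h /=.
have [_ lsig _ _ _] := sigma_rep.
(* These are [2 Re a] and [-2 Im a], so [2 a = a1 - i a2]. *)
pose a1 := a + star a; pose a2 := 'i *: (a - star a).
have s1 : star a1 = a1 by rewrite starD starK addrC.
have sN (x : A) : star (- x) = - star x.
  by rewrite -scaleN1r starZ rmorphN1 scaleN1r.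
have s2 : star a2 = a2.
  by rewrite starZ conjCi starD sN starK scaleNr -scalerN opprB.
have -> : a = 2^-1 *: (a1 - 'i *: a2).
  rewrite scalerA -expr2 sqrCi scaleN1r opprK /a1 addrACA subrr addr0.
  by rewrite -mulr2n -[a *+ 2]scaler_nat scalerA mulVf ?pnatr_eq0 // scale1r.
rewrite (linZ (lsig _)) (linB (lsig _)) (linZ (lsig _)).
rewrite [in RHS](linZ (lsig _)) [in RHS](linB (lsig _)) [in RHS](linZ (lsig _)).
by rewrite (linZ bb.1) (linB bb.1) (linZ bb.1) !bs.
Qed.

End Commutant.

(** * Intertwiners on the tensor product and equivalence of rows *)

Section Tensor.
Context {R : realType} {A : wstarType R} {E : wcorrType A} {H : hilbertType R}.
Context {sigma : A -> H -> H} (K : interior_tensor E sigma).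

(** The defect [B z w = inner (V z) w - inner z (V w)] is a bounded sesquilinear form. It vanishes
    on elementary tensors because the left action is a star-homomorphism, then on their span, then
    everywhere by density in each variable in turn. *)
Lemma tensor_l_selfadj (a : A) : star a = a ->
  is_adjoint (tensor_l (K := K) (lact a)) (tensor_l (K := K) (lact a)).
Proof.
(* In the default case of [xget] the operator is 0, which is self-adjoint as well. *)
move=> sa; rewrite /tensor_l; case: xgetP => [V _ [bV VE]|_] x y; last first.
  by rewrite inner0r inner0l.
set S := [set v | exists x h, v = tensor K x h].
have lV := bV.1; have [c c0 Vc] := bounded_pos bV.
pose B z w := inner (V z) w - inner z (V w).
have Bb z w : `|B z w| <= (2 * c * nrm z * nrm w)%:C%C.
  apply: le_trans (ler_normB _ _) _.
  apply: le_trans (lerD (cauchy_schwarz _ _) (cauchy_schwarz _ _)) _.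
  rewrite -rmorphD/= lecR.
  have : nrm (V z) * nrm w <= c * nrm z * nrm w by rewrite ler_wpM2r ?nrm_ge0.
  have : nrm z * nrm (V w) <= nrm z * (c * nrm w) by rewrite ler_wpM2l ?nrm_ge0.
  lra.
have BBl w : {morph B^~ w : z z' / z - z'}.
  move=> z z'; rewrite /B (linB lV) !innerBl !opprB.
  by rewrite addrACA [RHS]addrACA [- _ + _]addrC.
have BBr z : {morph B z : w w' / w - w'}.
  move=> w w'; rewrite /B (linB lV) !innerBr !opprB.
  by rewrite addrACA [RHS]addrACA [- _ + _]addrC.
have B0l w : B 0 w = 0 by have := BBl w 0 0; rewrite !subrr.
have B0r z : B z 0 = 0 by have := BBr z 0 0; rewrite !subrr.
have BNl z w : B (- z) w = - B z w by rewrite -sub0r BBl B0l sub0r.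
have BNr z w : B z (- w) = - B z w by rewrite -sub0r BBr B0r sub0r.
have BDl z z' w : B (z + z') w = B z w + B z' w.
  by rewrite -[z']opprK BBl BNl !opprK.
have BDr z w w' : B z (w + w') = B z w + B z w'.
  by rewrite -[w']opprK BBr BNr !opprK.
have BZl k z w : B (k *: z) w = Num.conj k * B z w.
  by rewrite /B (linZ lV) !innerZl mulrBr.
have BZr k z w : B z (k *: w) = k * B z w.
  by rewrite /B (linZ lV) !innerZr mulrBr.
have Bgen s t : S s -> S t -> B s t = 0.
  move=> [x1 [h1 ->]] [x2 [h2 ->]].
  by rewrite /B !VE !tensor_inner lact_star sa subrr.
have Bl s w : lspan S s -> S w -> B s w = 0.
  move=> [n [k [t [tS ->]]]] wS.
  apply: (@big_ind _ (fun z => B z w = 0)) => // [z z' zw z'w|i _].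
    by rewrite BDl zw z'w addr0.
  by rewrite BZl Bgen // mulr0.
have Bs s w : lspan S s -> lspan S w -> B s w = 0.
  move=> sS [n [k [t [tS ->]]]].
  apply: (@big_ind _ (fun z => B s z = 0)) => // [z z' zw z'w|i _].
    by rewrite BDr zw z'w addr0.
  by rewrite BZr Bl // mulr0.
suff : B x y = 0 by move/subr0_eq.
apply: (@dense_eq0 _ _ (lspan S) (B x) (2 * c * nrm x)) => //.
  exact: tensor_dense.
move=> w wS.
apply: (@dense_eq0 _ _ (lspan S) (B^~ w) (2 * c * nrm w)) => //.
- exact: tensor_dense.
- by move=> z; rewrite [2 * c * _ * _]mulrAC.
- by move=> z zS; exact: Bs.
Qed.

(** For self-adjoint [a], taking adjoints in the intertwining relation of [gS] shows that [gamma]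
    carries [sigma a] to [tensor_l (lact a)], and [eta] carries it back. *)
Lemma EsigmaS_comp_adjoint (sigma_rep : normal_rep sigma) (eta gS : K -> H) gamma :
  EsigmaS eta -> EsigmaS gS -> bounded_linear gamma -> is_adjoint gS gamma ->
  rep_commutant sigma (eta \o gamma).
Proof.
move=> [be es] [_ gs] bg gS_adj.
have [_ _ _ sadj _] := sigma_rep.
apply: commutant_selfadj => //; first exact: bounded_linear_comp.
move=> a sa h /=.
have -> : gamma (sigma a h) = tensor_l (lact a) (gamma h).
  apply: inner_eqr => z.
  rewrite -gS_adj -{1}sa -sadj -[sigma a (gS z)]/((sigma a \o gS) z) -gs /=.
  by rewrite gS_adj tensor_l_selfadj.
by have := congr1 (@^~ (gamma h)) (es a).
Qed.

Lemma EsigmaS_commutant b (eta : K -> H) : rep_commutant sigma b ->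
  EsigmaS eta -> EsigmaS (b \o eta).
Proof.
move=> [bb bs] [be es]; split; first exact: bounded_linear_comp.
by move=> a; rewrite -compA es compA bs.
Qed.

Lemma Pequiv_sym (p q : (H -> H) * (K -> H)) : Pequiv p q -> Pequiv q p.
Proof.
move=> [C [Cc [C' CC'] <-]]; exists C'; split => /=.
- exact: commutant_inverse Cc CC'.
- by exists C; case: CC' => *; split => //; case: Cc.
- case: CC' => _ CK _; case: p => p1 p2 /=.
  by congr pair; apply/funext => h /=; rewrite CK.
Qed.

Lemma Pequiv_trans (p q r : (H -> H) * (K -> H)) :
  Pequiv p q -> Pequiv q r -> Pequiv p r.
Proof.
move=> [C [Cc [C' CC'] <-]] [D [Dc [D' DD'] <-]]; exists (D \o C); split => //.
- exact: commutant_comp.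
- by exists (C' \o D'); exact: is_inverse_comp.
Qed.

Lemma Pclass_eq (p q : (H -> H) * (K -> H)) : Pequiv p q -> Pclass p = Pclass q.
Proof.
move=> pq; apply/seteqP; split => r [Pr] h; split => //.
  exact: Pequiv_trans (Pequiv_sym pq) h.
exact: Pequiv_trans pq h.
Qed.

End Tensor.

(** * Action of the block matrix on the row of a point of the ball *)

Theorem theorem3p3 (R : realType) (A : wstarType R) (E : wcorrType A)
    (H : hilbertType R) (sigma : A -> H -> H) (sigma_rep : normal_rep sigma)
    (K : interior_tensor E sigma) (F : fock E)
    (g : (K -> H) -> (K -> H))
    (alpha : (fock_space F -> fock_space F) -> (fock_space F -> fock_space F))
    (gamma : H -> K) (u : E -> E) :
  Aut_ball g ->
  Aut_Hardy alpha ->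
  implements g alpha ->
  Esigma gamma ->
  ball_center_EsigmaS (adjoint_op gamma) ->
  unitary_op u ->
  u @` corr_center E = corr_center E ->
  (forall eta : K -> H, ball_EsigmaS eta ->
     g eta = mobius gamma eta \o tensor_l u) ->
  forall eta : K -> H, ball_EsigmaS eta ->
    [/\ Prow (block_row_mul (idfun, eta) (mobius_mx gamma u)),
        Prow (idfun, g eta) &
        Pclass (block_row_mul (idfun, eta) (mobius_mx gamma u)) =
        Pclass (idfun, g eta)].
Proof.
move=> [g' [gball _ _ _ _]] _ _ [bg [gS0 [bgS0 _] gS0P]] [[EgS _] gS1] _ _ gE.
move=> eta etaB; have [Ee e1] := etaB.
(* Membership in [Esigma] supplies a bounded adjoint, so the choice made by [adjoint_op] is a
   genuine one. *)
have [bgS gadj] : bounded_linear (adjoint_op gamma) /\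
    is_adjoint gamma (adjoint_op gamma).
  apply: (@xgetPex _ _ [set f' | bounded_linear f' /\ is_adjoint gamma f']).
  by exists gS0; split => //; exact: is_adjoint_sym.
have gSadj := is_adjoint_sym gadj.
(* Operator norms being infima, strict inequality yields actual bounds [r, s < 1]. Then
   [adjoint_op gamma \o gamma] has bound [r * r] and [eta \o gamma] has bound [s * r], both below
   1. *)
have [r /andP[r0 r1] gSr] := opnorm_lt bgS gS1.
have gr := adjoint_bound gSadj r0 gSr.
have [s /andP[s0 s1] es] := opnorm_lt Ee.1 e1.
have cT := EsigmaS_comp_adjoint sigma_rep EgS EgS bg gSadj.
have cZ := EsigmaS_comp_adjoint sigma_rep Ee EgS bg gSadj.
have lt1 (c : R) : 0 <= c -> c < 1 -> 0 <= c * r /\ c * r < 1.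
  by move=> c0 c1; split; [rewrite mulr_ge0 | rewrite mulr_ilt1].
have bound (f : K -> H) (c : R) : 0 <= c -> (forall x, nrm (f x) <= c * nrm x) ->
    forall h, nrm ((f \o gamma) h) <= c * r * nrm h.
  move=> c0 fc h /=; apply: le_trans (fc _) _.
  by rewrite -mulrA ler_wpM2l.
have [rr0 rr1] := lt1 _ r0 r1; have [sr0 sr1] := lt1 _ s0 s1.
have [bD iD commD] : [/\ bounded_linear (Delta gamma),
    invertible_op (Delta gamma) & forall B : H -> H, bounded_linear B ->
      (forall x, adjoint_op gamma (gamma (B x)) = B (adjoint_op gamma (gamma x))) ->
      forall x, Delta gamma (B x) = B (Delta gamma x)].
  apply: (sqrt_op_spec cT.1 rr0 rr1 (bound _ _ r0 gSr)).
  by move=> x y /=; rewrite gSadj gadj.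
have [bsig _ _ _ _] := sigma_rep.
have cD : rep_commutant sigma (Delta gamma).
  split => // a; apply/funext => h /=; apply: commD => // x.
  by have := congr1 (@^~ x) (cT.2 a).
have DK := inverse_opP iD.
have cN : rep_commutant sigma (idfun - (eta \o gamma)).
  by apply: commutantB => //; exact: commutant_id.
have NK : is_inverse (idfun - (eta \o gamma))
    (inverse_op (idfun - (eta \o gamma))).
  apply: inverse_opP; exact: neumann cZ.1 sr0 sr1 (bound _ _ s0 es).
have cD' := commutant_inverse cD DK.
have cN' := commutant_inverse cN NK.
have DK' : is_inverse (inverse_op (Delta gamma)) (Delta gamma).
  by case: DK.
have CK := is_inverse_comp NK DK'.
set C := (idfun - (eta \o gamma)) \o _ in CK.
have cC : rep_commutant sigma C by exact: commutant_comp.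
(* In the second entry both sides are [adjoint_op gamma - eta] applied after the common factor
   [inverse_op (DeltaS gamma) \o tensor_l u]: on the right, [C] cancels [Delta gamma] and then the
   inverse of [idfun - (eta \o gamma)]. *)
have rowE : block_row_mul (idfun, eta) (mobius_mx gamma u) = (C, C \o g eta).
  have le := Ee.1.1; rewrite (gE _ etaB) /block_row_mul /=; congr pair.
    by apply/funext => h; rewrite /C !fctE /= (linN le).
  apply/funext => z; rewrite /C /mobius.
  case: DK => _ DK1 _; case: NK => _ _ NK2.
  rewrite [RHS]/= DK1 -[RHS]/((idfun - (eta \o gamma)) (inverse_op _ _)) NK2.
  by rewrite !fctE /= (linN le).
(* The intertwining property of [g eta] is read off from [g] preserving the ball, not from the
   Möbius formula. *)
have Eg : EsigmaS (g eta) by have [] := gball _ etaB.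
have iC : invertible_op C.
  by exists (Delta gamma \o inverse_op (idfun - (eta \o gamma))).
have Pq : Pequiv (K := K) (idfun, g eta) (C, C \o g eta) by exists C.
rewrite rowE; split.
- by split => //=; exact: EsigmaS_commutant.
- split => //=; first exact: commutant_id.
  by exists idfun; split => //; exact: bounded_linear_id.
- exact/esym/Pclass_eq.
Qed.
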